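(* Let $I$ be a non-empty subset of $\mathbb{N}$ and let $S$ be an ideal extension of $\mathbb{N}^{(I)}$. For every $\mathbf{a}\in\mathcal{A}(S)$, $\omega(\mathbf{a})\le\lVert\mathbf{a}\rVert_1+1$. In particular, $$\omega(S)\le 1+\sup_{\mathbf{a}\in\mathcal{A}(S)}\lVert\mathbf{a}\rVert_1 .$$
   Context: $\mathbb{N}$ is the set of non-negative integers. For a non-empty set $I\subseteq\mathbb{N}$, $\mathbb{N}^{(I)}$ is the additive monoid (componentwise addition) of all sequences $(n_i)_{i\in I}$ of non-negative integers with $n_i=0$ for all but finitely many $i$; $\mathbf{0}$ is the zero sequence, and $\lVert\mathbf{a}\rVert_1=\sum_{i\in I}a_i$ for $\mathbf{a}=(a_i)_{i\in I}$. A subset $E\subseteq\mathbb{N}^{(I)}$ is an ideal if $E+\mathbb{N}^{(I)}\subseteq E$; a submonoid $S$ is an ideal extension of $\mathbb{N}^{(I)}$ if $S=E\cup\{\mathbf{0}\}$ for some ideal $E$ of $\mathbb{N}^{(I)}$. Put $S^*=S\setminus\{\mathbf{0}\}$ and let $\mathcal{A}(S)=S^*\setminus(S^*+S^* )$ be the set of atoms. Write $\mathbf{a}\le_S\mathbf{b}$ if $\mathbf{b}-\mathbf{a}\in S$. For $\mathbf{s}\in S$, the $\omega$-primality $\omega(\mathbf{s})$ is the least positive integer $N$ such that whenever $\mathbf{s}\le_S\mathbf{s}_1+\cdots+\mathbf{s}_n$ with $\mathbf{s}_1,\dots,\mathbf{s}_n\in S$, there is $J\subseteq\{1,\dots,n\}$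 with $|J|\le N$ and $\mathbf{s}\le_S\sum_{j\in J}\mathbf{s}_j$ ($\omega(\mathbf{s})=\infty$ if there is no such $N$). Finally $\omega(S)=\sup\{\omega(\mathbf{a}):\mathbf{a}\in\mathcal{A}(S)\}\in\mathbb{N}\cup\{\infty\}$; suprema are taken in $\mathbb{N}\cup\{\infty\}$. *)

(* Defs.v *)
From HB Require Import structures.
From mathcomp Require Import all_boot all_order all_algebra.
From mathcomp Require Import finmap multiset.
From mathcomp Require Import all_classical.

Set Implicit Arguments.
Unset Strict Implicit.
Unset Printing Implicit Defensive.

Import Order.TTheory GRing.Theory.

Local Open Scope classical_set_scope.
Local Open Scope ring_scope.

(* The extended natural numbers, [None] being infinity. *)
Definition enat : Type := option nat.
Definition efin (n : nat) : enat := Some n.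
Definition einfty : enat := None.

Definition enat_le (x y : enat) : bool :=
  match x, y with
  | _, None => true
  | None, Some _ => false
  | Some m, Some n => (m <= n)%N
  end.

Definition enat_add (x y : enat) : enat :=
  if x is Some m then if y is Some n then efin (m + n) else einfty else einfty.

HB.instance Definition _ := Choice.on enat.

Fact enat_display : Order.disp_t. Proof. by []. Qed.

Lemma enat_le_refl : reflexive enat_le.
Proof. by case=> //= n; exact: leqnn. Qed.

Lemma enat_le_anti : antisymmetric enat_le.
Proof. by case=> [m|] [n|] //= /anti_leq ->. Qed.

Lemma enat_le_trans : transitive enat_le.
Proof. by case=> [n|] [m|] [p|] //=; exact: leq_trans. Qed.

HB.instance Definition _ :=
  Order.Le_isPOrder.Build enat_display enat
    enat_le_refl enat_le_anti enat_le_trans.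

Lemma enat_addA : associative enat_add.
Proof. by case=> [m|] [n|] [p|] //=; rewrite addnA. Qed.

Lemma enat_addC : commutative enat_add.
Proof. by case=> [m|] [n|] //=; rewrite addnC. Qed.

Lemma enat_add0 : left_id (efin 0) enat_add.
Proof. by case=> [m|]. Qed.

HB.instance Definition _ :=
  GRing.isNmodule.Build enat enat_addA enat_addC enat_add0.

(* The least upper bound in the extended naturals; it is 0 for the empty set. *)
Definition esup (A : set enat) : enat := supremum (efin 0) A.

Lemma esup_supremums (A : set enat) : supremums A (esup A).
Proof.
rewrite /esup /supremum; case: ifPn => [/eqP ->|_].
  by split=> [x //|[n|] _].
apply: xgetPex.
have [[n An]|nA] := pselect (exists n, `[< ubound A (efin n) >]); last first.
  exists einfty; split=> [x _|[n|] An]; first by case: x.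
    by case: nA; exists n; apply/asboolP.
  by [].
have exA : exists n, `[< ubound A (efin n) >] by exists n.
have [m /asboolP Am mP] := ex_minnP exA.
exists (efin m); split=> // -[k|] Ak //.
by apply: mP; apply/asboolP.
Qed.

(* The monoid N^(I). Its carrier is the type of multisets over I, whose library
   sum [msetD] is pointwise addition. *)
Definition fseqnat (I : set nat) : Type := {fsfun set_type I -> nat with 0%N}.

Section FSeqNat.
Variable I : set nat.

HB.instance Definition _ := Choice.copy (fseqnat I) {fsfun set_type I -> nat with 0%N}.

Lemma fseqnat_add0 : left_id (mset0 : fseqnat I) (@msetD (set_type I)).
Proof. exact: mset0D. Qed.

HB.instance Definition _ :=
  GRing.isNmodule.Build (fseqnat I) (@msetDA (set_type I)) (@msetDC (set_type I)) fseqnat_add0.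

Implicit Types (a b s : fseqnat I) (E S : set (fseqnat I)).

Lemma fseqnatD a b i : (a + b) i = (a i + b i)%N.
Proof. by rewrite [LHS](_ : _ = msetD a b i) ?msetE2. Qed.

Definition norm1 a : nat :=
  (\sum_(i <- finsupp a) a i)%N.

Definition is_ideal E : Prop := [set x + y | x in E & y in [set: fseqnat I]] `<=` E.

Definition is_submonoid S : Prop :=
  S 0 /\ [set x + y | x in S & y in S] `<=` S.

Definition is_ideal_extension S : Prop :=
  is_submonoid S /\ exists E, is_ideal E /\ S = E `|` [set 0].

Definition nonzero S : set (fseqnat I) := S `\ 0.

Definition atoms S : set (fseqnat I) :=
  nonzero S `\` [set x + y | x in nonzero S & y in nonzero S].

(* b - a is computed in Z^(I), hence lies in S iff b = a + c for some c in S. *)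
Definition leS S a b : Prop := exists2 c, S c & b = a + c.

Definition omega_bound S s (N : nat) : Prop :=
  (0 < N)%N /\
  forall (n : nat) (t : 'I_n -> fseqnat I), (forall j, S (t j)) ->
    leS S s (\sum_(j < n) t j) ->
    exists2 J : {set 'I_n}, (#|J| <= N)%N & leS S s (\sum_(j in J) t j).

Definition omega S s : enat :=
  if pselect (exists N, `[< omega_bound S s N >]) is left exN
  then efin (ex_minn exN) else einfty.

Definition omega_monoid S : enat := esup [set omega S a | a in atoms S].

End FSeqNat.

(* Main.v *)
(** Choosing indices one unit of [a] at a time yields a set [J] of at most
    [norm1 a] summands whose sum dominates [a] componentwise. If every summand
    outside [J] is zero, the sum over [J] is the full sum and we are done.
    Otherwise add one nonzero summand to [J]: it lies in the ideal, hence so does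
    the difference between the enlarged sum and [a]. *)

Require Import Defs.
From HB Require Import structures.
From mathcomp Require Import all_boot all_order all_algebra.
From mathcomp Require Import finmap multiset.
From mathcomp Require Import all_classical.

Set Implicit Arguments.
Unset Strict Implicit.
Unset Printing Implicit Defensive.

Import Order.TTheory GRing.Theory.

Local Open Scope classical_set_scope.
Local Open Scope ring_scope.

(** Greedy choice: while the selected terms total exactly [m] and the full sum exceeds [m], some
    unselected [f j] is positive; adding [j] costs one index and gains at least one unit. *)
Lemma subsum_geq (n m : nat) (f : 'I_n -> nat) :
  (m <= \sum_(j < n) f j)%N ->
  exists2 J : {set 'I_n}, (#|J| <= m)%N & (m <= \sum_(j in J) f j)%N.
Proof.
elim: m => [|m IHm] lt_m; first by exists finset.set0; rewrite ?cards0.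
have [J leJ geJ] := IHm (ltnW lt_m).
have [gtJ|leJm] := ltnP m (\sum_(j in J) f j); first by exists J; rewrite // ltnW.
have /existsP[j /andP[jNJ fj]] : [exists j, (j \notin J) && (0 < f j)%N].
  (* Otherwise [f] vanishes off [J], so the full sum equals the sum over [J] and is at most [m]. *)
  apply: contraLR lt_m => /existsPn f0; rewrite -leqNgt (leq_trans _ leJm) //.
  rewrite (bigID (mem J)) /= [X in (_ + X)%N]big1 ?addn0 // => j jNJ.
  by have := f0 j; rewrite jNJ lt0n /= negbK => /eqP.
exists (j |: J)%SET; first by rewrite cardsU1 jNJ.
by rewrite big_setU1 //= -add1n leq_add.
Qed.

Section IdealExtension.
Variable I : set nat.
Implicit Types (a b : fseqnat I) (S : set (fseqnat I)).

Lemma fseqnat_sumE (T : finType) (P : pred T) (t : T -> fseqnat I) i :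
  (\sum_(j | P j) t j) i = (\sum_(j | P j) t j i)%N.
Proof.
elim/big_rec2: _ => [|j x y _ <-]; last by rewrite fseqnatD.
exact: mset0E.
Qed.

Lemma fseqnat_subnKC a b : (forall i, (a i <= b i)%N) -> exists d, b = a + d.
Proof.
move=> le_ab; exists (msetB b a : fseqnat I); apply/fsfunP => i.
by rewrite fseqnatD msetE2 subnKC.
Qed.

(** One set from [subsum_geq] per coordinate [i] in the support of [a], of size at most [a i]; their
    union has size at most the sum of the [a i]. *)
Lemma subsum_norm1 (n : nat) (t : 'I_n -> fseqnat I) a :
  (forall i, (a i <= (\sum_(j < n) t j)%R i)%N) ->
  exists2 J : {set 'I_n}, (#|J| <= norm1 a)%N &
    exists d, \sum_(j in J) t j = a + d.
Proof.
move=> le_at.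
(* Off its support [a] is zero, so only support coordinates matter; viewing the support as a list
   allows induction on it. *)
suff [J leJ geJ] : exists2 J : {set 'I_n}, (#|J| <= norm1 a)%N &
    forall i, i \in (finsupp a : seq _) -> (a i <= (\sum_(j in J) t j)%R i)%N.
  exists J => //; apply: fseqnat_subnKC => i.
  by have [/geJ//|/fsfun_dflt->] := boolP (i \in finsupp a).
rewrite /norm1; elim: (finsupp a : seq _) => [|i r [J leJ geJ]].
  by exists finset.set0; rewrite ?cards0.
have [K leK geK] : exists2 K : {set 'I_n}, (#|K| <= a i)%N &
    (a i <= \sum_(j in K) t j i)%N.
  by apply: subsum_geq; rewrite -fseqnat_sumE.
(* Enlarging the index set preserves the coordinates already dominated, so unions are harmless. *)
have sub_le (A B : {set 'I_n}) k : A \subset B ->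
    ((\sum_(j in A) t j)%R k <= (\sum_(j in B) t j)%R k)%N.
  move=> /finset.setIidPr AB; rewrite !fseqnat_sumE.
  by rewrite [leqRHS](big_setID A) /= AB leq_addr.
exists (K :|: J)%SET.
  by rewrite big_cons (leq_trans (leq_card_setU _ _)) // leq_add.
move=> k; rewrite inE => /predU1P[->|/geJ leJk].
  by rewrite -fseqnat_sumE in geK; rewrite (leq_trans geK) // sub_le ?finset.subsetUl.
by rewrite (leq_trans leJk) // sub_le ?finset.subsetUr.
Qed.

Lemma ideal_extension_absorb S a b :
  is_ideal_extension S -> S a -> a != 0 -> S (b + a).
Proof.
move=> [_ [E [idE ->]]] [Ea _|-> /eqP//]; left.
by apply: idE; exists a => //; exists b; rewrite // addrC.
Qed.

Lemma omega_bound_norm1 S a :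
  is_ideal_extension S -> omega_bound S a (norm1 a + 1).
Proof.
move=> S_ext; split=> [|n t St [c Sc tE]]; first by rewrite addn1.
have [i|J leJ [d JE]] := @subsum_norm1 n t a.
  by rewrite tE fseqnatD leq_addr.
have [/existsP[j /andP[jNJ tj]]|/existsPn t0] :=
    boolP [exists j, (j \notin J) && (t j != 0)].
  exists (j |: J)%SET; first by rewrite cardsU1 jNJ add1n addn1.
  (* [d] itself may lie outside [S]; the nonzero summand [t j] absorbs it. *)
  exists (d + t j); first exact: ideal_extension_absorb.
  by rewrite big_setU1 //= JE addrC addrA.
exists J; first by rewrite (leq_trans leJ) ?leq_addr.
exists c => //; rewrite -tE [RHS](bigID (mem J)) /= [X in _ + X]big1 ?addr0 //.
by move=> j jNJ; have := t0 j; rewrite jNJ /= negbK => /eqP.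
Qed.

Lemma omega_le S a N : omega_bound S a N -> (omega S a <= efin N)%O.
Proof.
move=> aN; rewrite /omega; case: pselect => [exN|[]]; last first.
  by exists N; apply/asboolP.
by case: ex_minnP => m _; apply; apply/asboolP.
Qed.

End IdealExtension.

Lemma le_enat_add2l (x y z : enat) : (y <= z)%O -> (x + y <= x + z)%O.
Proof. by case: x y z => [x|] [y|] [z|] //; rewrite /Order.le /= leq_add2l. Qed.

Theorem theorem6p2 (I : set nat) (I_neq0 : I !=set0)
    (S : set (fseqnat I)) (S_ext : is_ideal_extension S) :
  (forall a : fseqnat I, atoms S a -> (omega S a <= efin (norm1 a + 1))%O) /\
  (omega_monoid S <= efin 1 + esup [set efin (norm1 a) | a in atoms S])%O.
Proof.
have le_omega a : (omega S a <= efin (norm1 a + 1))%O.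
  exact/omega_le/omega_bound_norm1.
split=> [a _|]; first exact: le_omega.
(* Leastness of the supremum: it suffices to bound each [omega S a] separately. *)
apply: (esup_supremums _).2 => _ [a Sa <-].
apply: (le_trans (le_omega a)); rewrite addnC.
apply: (@le_enat_add2l (efin 1) (efin (norm1 a))).
by apply: (esup_supremums _).1; exists a.
Qed.
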